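(* Let $(\mathcal{X}_\alpha,\mathcal{P}_\alpha)_{\alpha\in A}$ be an arbitrary collection in which each $\mathcal{X}_\alpha$ is a finite set and each $\mathcal{P}_\alpha\subseteq\{0,1\}^{\mathcal{X}_\alpha}$ is a property. The following are equivalent: (i) the collection is constant-sample testable, i.e. for every $\epsilon>0$ there is an integer $s=s(\epsilon)$, independent of $\alpha$, such that for every $\alpha\in A$ the property $\mathcal{P}_\alpha$ has an $s$-sample $\epsilon$-tester; (ii) for every $\epsilon>0$ there is an integer $k=k(\epsilon)$, independent of $\alpha$, such that for every $\alpha\in A$ there exists a $k$-part symmetric property $\mathcal{P}'_\alpha\subseteq\{0,1\}^{\mathcal{X}_\alpha}$ with $\mathcal{P}_\alpha\subseteq\mathcal{P}'_\alpha\subseteq(\mathcal{P}_\alpha)_\epsilon$.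
   Context: For a finite set $\mathcal{X}$, $\{0,1\}^{\mathcal{X}}$ is the set of functions $f:\mathcal{X}\to\{0,1\}$ with normalized Hamming distance $\mathrm{d}(f,g)=|\{x: f(x)\neq g(x)\}|/|\mathcal{X}|$. A property is a subset $\mathcal{P}\subseteq\{0,1\}^{\mathcal{X}}$. For $\epsilon>0$, $\mathcal{P}_\epsilon=\{f:\exists g\in\mathcal{P},\ \mathrm{d}(f,g)\le\epsilon\}$; $f$ is $\epsilon$-far from $\mathcal{P}$ if $f\notin\mathcal{P}_\epsilon$. An $s$-sample tester is a randomized algorithm that receives $(x_1,f(x_1)),\dots,(x_s,f(x_s))$ where $x_1,\dots,x_s$ are drawn independently and uniformly from $\mathcal{X}$, and accepts or rejects; equivalently it is given by a function $T:\mathcal{X}^s\times\{0,1\}^s\to[0,1]$ (the acceptance probability on samples $\mathbf{x}$ with labels $\mathbf{y}$), and its acceptance probability on $f$ is $p_T(f)=\mathbb{E}_{\mathbf{x}}[T(\mathbf{x},f(\mathbf{x}))]$ with $f(\mathbf{x})=(f(x_1),\dots,f(x_s))$. It is an $s$-sample $\epsilon$-tester for $\mathcal{P}$ if $p_T(f)\ge 2/3$ for every $f\in\mathcal{P}$ and $p_T(f)\le 1/3$ for every $f$ that is $\epsilon$-far from $\mathcal{P}$. A property $\mathcal{P}\subseteq\{0,1\}^{\mathcal{X}}$ is $k$-part symmetric if there is a partition $X_1,\dots,X_k$ of $\mathcal{X}$ such that for every permutation $\pi$ of $\mathcal{X}$ with $\pi(X_i)=X_i$ for all $i$, and every $f\in\mathcal{P}$,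 the function $\pi f$ defined by $(\pi f)(x)=f(\pi x)$ is in $\mathcal{P}$ (equivalently, membership of $f$ in $\mathcal{P}$ depends only on the densities $|f^{-1}(1)\cap X_i|/|X_i|$, $i=1,\dots,k$). *)

(* Defs.v *)
From HB Require Import structures.
From mathcomp Require Import all_boot all_order all_fingroup all_algebra.
From mathcomp Require Import reals.

Set Implicit Arguments.
Unset Strict Implicit.
Unset Printing Implicit Defensive.

Import Order.TTheory GRing.Theory Num.Theory.

Local Open Scope ring_scope.

Definition property (X : finType) := {set {ffun X -> bool}}.

Definition hamming_dist (R : realType) (X : finType) (f g : {ffun X -> bool}) : R :=
  #|[set x | f x != g x]|%:R / #|X|%:R.

Definition neighborhood (R : realType) (X : finType) (P : property X) (eps : R)
    : property X :=
  [set f | [exists g in P, hamming_dist R f g <= eps]].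

Definition far (R : realType) (X : finType) (P : property X) (eps : R)
    (f : {ffun X -> bool}) : Prop :=
  f \notin neighborhood P eps.

(* [T x y] is the probability of accepting on the samples [x] with labels [y]. *)
Definition sample_tester (R : realType) (X : finType) (s : nat)
    (T : s.-tuple X -> s.-tuple bool -> R) : Prop :=
  forall x y, 0 <= T x y <= 1.

(* Average over the uniform distribution on [s.-tuple X], i.e. over [s]
   independent uniform samples; meaningful when [X] is nonempty. *)
Definition accept_prob (R : realType) (X : finType) (s : nat)
    (T : s.-tuple X -> s.-tuple bool -> R) (f : {ffun X -> bool}) : R :=
  (\sum_(x : s.-tuple X) T x (map_tuple f x)) / #|{: s.-tuple X}|%:R.

Definition eps_tester (R : realType) (X : finType) (P : property X) (eps : R)
    (s : nat) (T : s.-tuple X -> s.-tuple bool -> R) : Prop :=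
  [/\ sample_tester T,
      forall f, f \in P -> 2%:R / 3%:R <= accept_prob T f
    & forall f, far P eps f -> accept_prob T f <= 1 / 3%:R].

(* Parts may be empty: otherwise no [k] could serve sets with fewer than [k]
   elements. *)
Definition is_partition (X : finType) (k : nat) (part : 'I_k -> {set X}) : Prop :=
  (forall i j, i != j -> [disjoint part i & part j]) /\
  \bigcup_(i < k) part i = [set: X].

Definition perm_fun (X : finType) (pi : {perm X}) (f : {ffun X -> bool})
    : {ffun X -> bool} :=
  [ffun x => f (pi x)].

Definition part_symmetric (X : finType) (k : nat) (P : property X) : Prop :=
  exists part : 'I_k -> {set X}, is_partition part /\
    forall pi : {perm X}, (forall i, pi @: part i = part i) ->
    forall f, f \in P -> perm_fun pi f \in P.

Definition constant_sample_testable (R : realType) (A : Type) (X : A -> finType)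
    (P : forall a, property (X a)) : Prop :=
  forall eps : R, 0 < eps ->
  exists s : nat, forall a : A,
  exists T : s.-tuple (X a) -> s.-tuple bool -> R, eps_tester (P a) eps T.

(* Main.v *)
Require Import Defs.
From HB Require Import structures.
From mathcomp Require Import all_boot all_order all_fingroup all_algebra.
From mathcomp Require Import reals ring lra.
Import Order.TTheory GRing.Theory Num.Theory.
Local Open Scope ring_scope.

(** From testers to symmetry: let [u_f] be the indicator of the pairs (sample,
    labels) consistent with [f], so that the acceptance probability of [T] on [f]
    is the normalized inner product [<T, u_f>].  As long as some [<T, u_f>] is
    large, subtracting the projection of [T] on [u_f] lowers the energy [|T|^2],
    so a bounded number of functions [f_1, ..., f_n] suffices to write
    [T = sum_i c_i u_(f_i)] up to an error almost orthogonal to all the [u_g].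
    A permutation preserving the atoms of [f_1, ..., f_n] fixes each [f_i], hence
    preserves [<u_(f_i), u_g>] and almost preserves the acceptance probability:
    closing the property under these permutations stays within its
    [eps]-neighborhood.

    From symmetry to testers: by Chebyshev, boundedly many samples estimate the
    densities of [f] on all the parts, and a symmetric property whose members
    have almost the same densities as [f] contains a function close to [f]. *)

(** * Energy decrement for vectors of bounded norm *)

Section EnergyDecrement.

Variables (R : realType) (J : finType) (I : Type) (u : I -> J -> R) (N : R).

Let dot (a b : J -> R) : R := \sum_j a j * b j.

Lemma dot_subr a b c t :
  dot (fun j => a j - t * b j) c = dot a c - t * dot b c.
Proof.
rewrite /dot mulr_sumr -sumrB; apply: eq_bigr => j _; ring.
Qed.

Lemma dotC a b : dot a b = dot b a.
Proof. by apply: eq_bigr => j _; rewrite mulrC. Qed.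

Lemma dot_ge0 a : 0 <= dot a a.
Proof. by apply: sumr_ge0 => j _; rewrite -expr2 sqr_ge0. Qed.

Hypothesis N_gt0 : 0 < N.
Hypothesis u_le : forall i, dot (u i) (u i) <= N.

(** Induction on [n], the number of decrements the energy can pay for: while some [u i] correlates
    with [F] beyond [gam * N], subtracting a multiple of it removes at least [gam ^+ 2 * N].
    Subtracted terms cancel in the difference when [u g] and [u g'] agree against the chosen
    vectors. *)
Lemma energy_decrement (i0 : I) (gam : R) (n : nat) (F : J -> R) :
  0 < gam -> dot F F <= n%:R * gam ^+ 2 * N ->
  exists h : n.-tuple I, forall g g',
    (forall m, dot (u (tnth h m)) (u g) = dot (u (tnth h m)) (u g')) ->
    `|dot F (u g) - dot F (u g')| <= 2 * gam * N.
Proof.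
move=> gam0; elim: n F => [|n IHn] F FF.
  exists [tuple] => g g' _.
  suff F0 j : F j = 0.
    by rewrite /dot !big1 ?subrr ?normr0 ?mulr_ge0 ?(ltW gam0) ?(ltW N_gt0) // => j _;
       rewrite F0 mul0r.
  have /eqP : dot F F = 0 by apply: le_anti; rewrite dot_ge0 andbT; move: FF; rewrite !mul0r.
  rewrite psumr_eq0 => [/allP /(_ j (mem_index_enum j))|k _]; last by rewrite -expr2 sqr_ge0.
  by rewrite /= mulf_eq0 orbb => /eqP.
have [small|/boolp.existsNP[i /negP]] :=
    boolp.EM (forall i, `|dot F (u i)| <= gam * N).
  (* No large correlation is left, so the triangle inequality suffices; [i0] pads the tuple to its
     prescribed length. *)
  exists (nseq_tuple n.+1 i0) => g g' _.
  apply: le_trans (ler_normB _ _) _.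
  by have := small g; have := small g'; lra.
rewrite -ltNge => big.
(* With [N] in place of the squared norm of [u i], the energy still drops by at least
   [2 c^2 N - c^2 N = c^2 N]. *)
pose c := dot F (u i) / N.
have cN : c * N = dot F (u i) by rewrite /c divfK // gt_eqF.
pose F' j := F j - c * u i j.
have F'F' : dot F' F' <= n%:R * gam ^+ 2 * N.
  rewrite /F' dot_subr ![dot _ (fun j => _ - _)]dotC !dot_subr.
  rewrite [dot (u i) F]dotC -cN.
  have c2 : gam ^+ 2 <= c ^+ 2.
    rewrite -(real_normK (num_real c)) ler_pXn2r ?nnegrE ?(ltW gam0) //.
    by rewrite -(ler_pM2r N_gt0) -[X in _ <= _ * X](gtr0_norm N_gt0) -normrM cN ltW.
  have := ler_wpM2l (sqr_ge0 c) (u_le i).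
  have := ler_wpM2r (ltW N_gt0) c2.
  move: FF; rewrite -natr1.
  move: (dot _ _) (dot _ _) => A B; nra.
have [h hP] := IHn F' F'F'.
exists [tuple of i :: h] => g g' eqg.
have -> : dot F (u g) - dot F (u g') = dot F' (u g) - dot F' (u g').
  rewrite !dot_subr; have := eqg ord0; rewrite !tnth0 => ->; ring.
by apply: hP => m; have := eqg (lift ord0 m); rewrite !tnthS.
Qed.

End EnergyDecrement.

(** * From testers to symmetric properties *)

Section TestableSymmetric.

Variables (R : realType) (X : finType) (s : nat).

(* [label_graph f] is the indicator of the event that the sample [p.1] is
   labelled [p.2], so that acceptance probabilities are inner products with it. *)
Definition label_graph (f : {ffun X -> bool}) (p : s.-tuple X * s.-tuple bool) : R :=
  (p.2 == map_tuple f p.1)%:R.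

Lemma sum_label_graph (F : s.-tuple X * s.-tuple bool -> R) f :
  \sum_p F p * label_graph f p = \sum_x F (x, map_tuple f x).
Proof.
rewrite (eq_bigr (fun p => (fun x y => F (x, y) * label_graph f (x, y)) p.1 p.2)); last by case.
rewrite -(pair_bigA _ (fun x y => F (x, y) * label_graph f (x, y))) /=.
apply: eq_bigr => x _.
rewrite (bigD1 (map_tuple f x)) //= big1 ?addr0 => [|y /negPf ne].
  by rewrite /label_graph eqxx mulr1.
by rewrite /label_graph /= ne mulr0.
Qed.

(** Each side counts the samples on which the two functions give the same labels; moving the samples
    by [pi] matches the two counts. *)
Lemma dot_label_graph_perm (pi : {perm X}) (f g : {ffun X -> bool}) :
  (forall x, f (pi x) = f x) ->
  \sum_p label_graph f p * label_graph (perm_fun pi g) p =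
  \sum_p label_graph f p * label_graph g p.
Proof.
move=> fpi; rewrite !sum_label_graph.
have mapK (p q : {perm X}) : cancel p q ->
    cancel (map_tuple p : s.-tuple X -> s.-tuple X) (map_tuple q).
  by move=> pK x; apply: val_inj => /=; rewrite mapK.
rewrite [RHS](reindex (map_tuple pi)) /=; last first.
  exists (map_tuple (pi^-1)%g) => x _.
    exact: (mapK _ _ (permK pi)).
  exact: (mapK _ _ (permKV pi)).
apply: eq_bigr => x _; rewrite /label_graph -!val_eqE /= -!map_comp.
congr ((_ == _)%:R); last by apply: eq_map => z /=; rewrite fpi.
by apply: eq_map => z /=; rewrite ffunE.
Qed.

(* The constant is [|T|^2 / gam^2] with [|T|^2 <= 2^s] and [gam = 1/7], so that
   [2 gam] is below the gap [1/3] of the tester. *)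
Lemma tester_almost_symmetric (T : s.-tuple X -> s.-tuple bool -> R) :
  (0 < #|X|)%N -> sample_tester T ->
  exists h : (49 * 2 ^ s).-tuple {ffun X -> bool}, forall pi : {perm X},
    (forall m x, tnth h m (pi x) = tnth h m x) ->
    forall f, `|accept_prob T (perm_fun pi f) - accept_prob T f| <= 2 / 7.
Proof.
move=> X0 T01.
pose N : R := #|{: s.-tuple X}|%:R.
have N0 : 0 < N by rewrite ltr0n card_tuple expn_gt0 X0.
have uN f : \sum_p label_graph f p * label_graph f p <= N.
  rewrite sum_label_graph (eq_bigr (fun=> 1)) ?sumr_const // => x _.
  by rewrite /label_graph eqxx.
have TT : \sum_p T p.1 p.2 * T p.1 p.2 <= (49 * 2 ^ s)%N%:R * (1 / 7) ^+ 2 * N.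
  have -> : (49 * 2 ^ s)%N%:R * (1 / 7) ^+ 2 * N = \sum_(p : s.-tuple X * s.-tuple bool) 1.
    rewrite sumr_const card_prod [#|{: s.-tuple bool}|]card_tuple card_bool !natrM /N.
    by field.
  by apply: ler_sum => p _; have /andP[? ?] := T01 p.1 p.2; nra.
have [|h hP] := @energy_decrement R _ _ label_graph N N0 uN [ffun=> false] (1 / 7) _
   (fun p => T p.1 p.2) _ TT; first lra.
exists h => pi hpi f.
have acc g : accept_prob T g = (\sum_p T p.1 p.2 * label_graph g p) / N.
  by rewrite (sum_label_graph (fun p => T p.1 p.2)).
rewrite !acc -mulrBl normrM normfV (gtr0_norm N0) ler_pdivrMr //.
rewrite (_ : 2 / 7 = 2 * (1 / 7)); last lra.
apply: hP => m; exact: dot_label_graph_perm.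
Qed.

Lemma tester_symmetric (P : property X) (eps : R)
    (T : s.-tuple X -> s.-tuple bool -> R) :
  (0 < #|X|)%N -> eps_tester P eps T ->
  exists P' : property X,
    [/\ part_symmetric #|{: (49 * 2 ^ s).-tuple bool}| P',
        P \subset P' & P' \subset neighborhood P eps].
Proof.
move=> X0 [T01 Tacc Trej].
have [h hP] := @tester_almost_symmetric T X0 T01.
(* The parts are the atoms of the functions in [h], one for each possible vector of values, so their
   number depends on [s] alone. *)
pose atom x := map_tuple (fun f : {ffun X -> bool} => f x) h.
pose part (i : 'I_#|{: (49 * 2 ^ s).-tuple bool}|) := [set x | atom x == enum_val i].
pose stab (pi : {perm X}) := [forall i, pi @: part i == part i].
pose P' := [set f | [exists pi : {perm X}, stab pi && (perm_fun pi f \in P)]].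
have stabP (pi : {perm X}) : reflect (forall x, atom (pi x) = atom x) (stab pi).
  apply: (iffP forallP) => [st x|eqa i].
    have: pi x \in pi @: part (enum_rank (atom x)).
      by rewrite imset_f // inE enum_rankK.
    by rewrite (eqP (st _)) inE enum_rankK => /eqP.
  rewrite eqEcard card_imset ?leqnn ?andbT; last exact: perm_inj.
  by apply/subsetP => _ /imsetP[x + ->]; rewrite !inE eqa.
exists P'; split.
- exists part; split; first split.
  + move=> i j ij; rewrite -setI_eq0; apply/eqP/setP => x; rewrite !inE.
    apply/negP => /andP[/eqP-> /eqP/enum_val_inj eqij].
    by rewrite eqij eqxx in ij.
  + apply/setP => x; rewrite inE; apply/bigcupP.
    by exists (enum_rank (atom x)) => //; rewrite inE enum_rankK.
  move=> sig sigP f; rewrite !inE => /existsP[pi /andP[/stabP piP fP]].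
  have /stabP sigA : stab sig by apply/forallP => i; rewrite sigP.
  (* Products act left to right, so the inverse of [sig] cancels the [sig] already applied to
     [f]. *)
  apply/existsP; exists (pi * sig^-1)%g; apply/andP; split.
    apply/stabP => x; rewrite permM -[RHS]piP -[in RHS](permKV sig (pi x)).
    by rewrite sigA.
  rewrite (_ : perm_fun _ _ = perm_fun pi f) //.
  by apply/ffunP => x; rewrite !ffunE permM permKV.
- apply/subsetP => f fP; rewrite inE; apply/existsP; exists 1%g.
  rewrite (_ : perm_fun _ _ = f) ?fP ?andbT; last first.
    by apply/ffunP => x; rewrite ffunE perm1.
  by apply/stabP => x; rewrite perm1.
apply/subsetP => f; rewrite inE => /existsP[pi /andP[/stabP piP fP]].
(* A far [f] would be accepted with probability at most [1/3], whereas closeness to a member of [P]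
   forces at least [2/3 - 2/7 = 8/21]. *)
apply/negPn/negP => /Trej rej.
have := Tacc _ fP; have := hP pi _ f.
rewrite ler_norml => /(_ _)/andP[|_].
  by move=> m x; have := congr1 (fun t => tnth t m) (piP x); rewrite !tnth_map.
lra.
Qed.

End TestableSymmetric.

(** * From symmetric properties to testers, starting with concentration of sample sums *)

Section SymmetricTestable.

Variables (R : realType) (X : finType).

Lemma sum_tuple_cons s (F : s.+1.-tuple X -> R) :
  \sum_x F x = \sum_(z : X) \sum_(x : s.-tuple X) F [tuple of z :: x].
Proof.
rewrite pair_bigA /=.
rewrite (reindex (fun p : X * s.-tuple X => [tuple of p.1 :: p.2])) //=.
exists (fun x => (thead x, [tuple of behead x])) => [[z x] _|x _] /=.
  by congr (_, _); apply: val_inj.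
by rewrite [RHS]tuple_eta.
Qed.

(** Adding one sample contributes at most 1 on average, the cross term vanishing because [a] has
    mean zero. *)
Lemma second_moment_sum (a : X -> R) s :
  \sum_z a z = 0 -> (forall z, `|a z| <= 1) ->
  \sum_(x : s.-tuple X) (\sum_(z <- x) a z) ^+ 2 <= s%:R * #|{: s.-tuple X}|%:R.
Proof.
move=> a0 a1; elim: s => [|s IHs].
  by rewrite mul0r big1 // => x _; rewrite tuple0 big_nil expr0n.
have cardS : #|{: s.+1.-tuple X}|%:R = #|X|%:R * #|{: s.-tuple X}|%:R :> R.
  by rewrite !card_tuple expnS natrM.
rewrite sum_tuple_cons.
have -> : \sum_z \sum_(x : s.-tuple X) (\sum_(t <- [tuple of z :: x]) a t) ^+ 2 =
   \sum_z a z ^+ 2 *+ #|{: s.-tuple X}| 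
    + (\sum_z a z) * (\sum_(x : s.-tuple X) 2 * \sum_(t <- x) a t)
    + (\sum_(x : s.-tuple X) (\sum_(t <- x) a t) ^+ 2) *+ #|X|.
  rewrite -[X in _ + X]sumr_const mulr_suml -!big_split /=.
  apply: eq_bigr => z _; rewrite -sumr_const mulr_sumr -!big_split /=.
  by apply: eq_bigr => x _; rewrite big_cons; ring.
rewrite a0 mul0r addr0 -natr1 mulrDl mul1r addrC lerD //.
  rewrite cardS mulrCA [X in _ <= X]mulrC -[X in X <= _]mulr_natr.
  exact: ler_wpM2r.
rewrite cardS.
apply: le_trans (_ : \sum_(z : X) #|{: s.-tuple X}|%:R <= _).
  apply: ler_sum => z _; apply: ler_wMn2r.
  by rewrite -(real_normK (num_real _)) exprn_ile1.
by rewrite sumr_const -[X in X <= _]mulr_natl.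
Qed.

(** Markov's inequality for the squared sum, with denominators cleared so that [s = 0] is
    covered. *)
Lemma chebyshev_card (a : X -> R) s (d : R) :
  0 < d -> \sum_z a z = 0 -> (forall z, `|a z| <= 1) ->
  #|[set x : s.-tuple X | s%:R * d < `|\sum_(z <- x) a z|]|%:R * (s%:R * d ^+ 2)
    <= #|{: s.-tuple X}|%:R.
Proof.
move=> d0 a0 a1; case: s => [|s]; first by rewrite !(mul0r, mulr0).
have s0 : 0 < s.+1%:R :> R by rewrite ltr0n.
rewrite -(ler_pM2l s0); apply: le_trans (second_moment_sum _ s.+1 a0 a1).
rewrite -sum1_card natr_sum !mulr_suml mulr_sumr.
rewrite [X in _ <= X](bigID (mem [set x : s.+1.-tuple X | s.+1%:R * d < `|\sum_(z <- x) a z|])) /=.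
rewrite -[X in X <= _]addr0; apply: lerD; last by apply: sumr_ge0 => x _; exact: sqr_ge0.
apply: ler_sum => x; rewrite inE => /ltW lt.
rewrite mul1r mulrA -expr2 -exprMn -[X in _ <= X](real_normK (num_real _)).
by rewrite ler_pXn2r ?nnegrE // mulr_ge0 // ltW.
Qed.

(** * Distance controlled by counts on the parts, and estimation of these counts *)

Variables (k : nat) (part : 'I_k -> {set X}).
Hypothesis partP : is_partition part.

Let cnt (f : {ffun X -> bool}) i : R := \sum_(x in part i) (f x)%:R.
Let dis (f g : {ffun X -> bool}) := #|[set x | f x != g x]|.

Lemma dis_swap (f g : {ffun X -> bool}) x y :
  f x -> ~~ g x -> ~~ f y -> g y -> (dis f (perm_fun (tperm x y) g) < dis f g)%N.
Proof.
move=> fx gx fy gy; rewrite /dis; apply/proper_card/properP; split.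
  apply/subsetP => z; rewrite !inE ffunE.
  case: tpermP => [->|->|//]; first by rewrite fx gy.
  by rewrite (negPf fy) (negPf gx).
by exists x; rewrite !inE ?ffunE ?tpermL fx ?gy.
Qed.

Lemma tperm_part x y i : x \in part i -> y \in part i ->
  forall j, tperm x y @: part j = part j.
Proof.
move=> xi yi j; apply/eqP; rewrite eqEcard card_imset ?leqnn ?andbT; last exact: perm_inj.
apply/subsetP => _ /imsetP[z zj ->].
have unq w : w \in part i -> w \in part j -> i = j.
  move=> wi wj; apply/eqP/negPn/negP => /(proj1 partP).
  by rewrite disjoint_subset => /subsetP /(_ _ wi); rewrite inE wj.
by case: tpermP zj => [->|->|//] wj; rewrite -(unq _ _ wj).
Qed.

Lemma cnt_perm (pi : {perm X}) f i : pi @: part i = part i ->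
  cnt (perm_fun pi f) i = cnt f i.
Proof.
move=> pii; rewrite /cnt -{2}pii big_imset /=; last by move=> ? ? _ _; exact: perm_inj.
by apply: eq_bigr => x _; rewrite ffunE.
Qed.

Lemma symmetric_close (P : property X) (f g : {ffun X -> bool}) :
  (forall pi : {perm X}, (forall i, pi @: part i = part i) ->
     forall h, h \in P -> perm_fun pi h \in P) ->
  g \in P ->
  exists2 h, h \in P & (dis f h)%:R <= \sum_i `|cnt f i - cnt g i|.
Proof.
move=> Psym gP.
(* Among the functions of [P] with the counts of [g], one closest to [f] cannot
   disagree with [f] in both directions on a part: swapping would do better. *)
have Q0 : (g \in P) && [forall i, cnt g i == cnt g i].
  by rewrite gP; apply/forallP.
case: (@arg_minnP _ g (fun h => (h \in P) && [forall i, cnt h i == cnt g i]) (dis f) Q0).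
move=> h /andP[hP /forallP hg] hmin; exists h => //.
have noswap x y i : x \in part i -> y \in part i -> f x -> ~~ h x -> ~~ f y -> h y -> False.
  move=> xi yi fx hx fy hy; have := dis_swap f h x y fx hx fy hy.
  have tp := tperm_part x y i xi yi.
  rewrite ltnNge hmin // Psym //=; apply/forallP => j.
  by rewrite cnt_perm // tp.
rewrite /dis -sum1_card natr_sum.
have -> : \sum_(x in [set x | f x != h x]) 1%:R =
    \sum_(x in \bigcup_i part i) `|(f x)%:R - (h x)%:R| :> R.
  rewrite (proj2 partP) big_mkcond /=; apply: eq_big => x; first by rewrite inE.
  by rewrite inE; case: (f x); case: (h x); rewrite /= ?subrr ?normr0 ?subr0 ?sub0r ?normrN ?normr1.
rewrite partition_disjoint_bigcup /=; last exact: (proj1 partP).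
apply: ler_sum => i _; rewrite -(eqP (hg i)) /cnt -sumrB.
(* All disagreements on a part have the same sign, so the absolute value passes through the sum. *)
have [/exists_inP[x xi /andP[fx hx]]|/exists_inPn none] :=
    boolP [exists x in part i, f x && ~~ h x].
  rewrite ger0_norm; last apply: sumr_ge0; last first.
    move=> y yi; have := @noswap x y i xi yi fx hx.
    by case: (f y); case: (h y) => //= ns; rewrite ?subrr ?subr0 //; case: (ns isT isT).
  apply: ler_sum => y yi; have := @noswap x y i xi yi fx hx.
  case: (f y); case: (h y) => //= ns; rewrite ?subrr ?subr0 ?normr0 ?normr1 //.
  by case: (ns isT isT).
rewrite ler0_norm; last first.
  apply: sumr_le0 => y yi; have := none y yi.
  by case: (f y); case: (h y) => //= _; rewrite ?subrr ?sub0r ?lerN10.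
rewrite -sumrN; apply: ler_sum => y yi; have := none y yi.
by case: (f y); case: (h y) => //= _; rewrite ?subrr ?sub0r ?opprK ?normrN ?normr1 ?normr0 ?oppr0.
Qed.

(** Dividing by the size of [X], not of the part, makes this the expectation of one summand of
    [est], with no special case for small or empty parts. *)
Let mean (f : {ffun X -> bool}) i : R := cnt f i / #|X|%:R.
Let est s (x : s.-tuple X) (y : s.-tuple bool) i : R :=
  \sum_(j < s) ((tnth x j \in part i) && tnth y j)%:R.
Let bad s (d : R) (f : {ffun X -> bool}) :=
  [set x : s.-tuple X |
    [exists i, s%:R * d < `|est s x (map_tuple f x) i - s%:R * mean f i|]].

(** Chebyshev for the centred indicator of each part, then a union bound over the [k] parts. *)
Lemma card_bad s (d : R) f : (0 < #|X|)%N -> 0 < d -> 3 * k%:R <= s%:R * d ^+ 2 ->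
  (0 < s)%N -> #|bad s d f|%:R <= #|{: s.-tuple X}|%:R / 3 :> R.
Proof.
move=> X0 d0 ks s0.
have X0R : 0 < #|X|%:R :> R by rewrite ltr0n.
pose a i z : R := ((z \in part i) && f z)%:R - mean f i.
have cntE i : cnt f i = \sum_z ((z \in part i) && f z)%:R.
  by rewrite /cnt big_mkcond; apply: eq_bigr => z _; case: (z \in part i).
have mean01 i : 0 <= mean f i <= 1.
  rewrite /mean divr_ge0 ?ler0n ?sumr_ge0 //= ler_pdivrMr // mul1r cntE.
  rewrite -sum1_card natr_sum; apply: ler_sum => z _.
  by case: (_ && _).
have a0 i : \sum_z a i z = 0.
  rewrite sumrB -cntE sumr_const -[X in _ - X]mulr_natr /mean divfK ?subrr //.
  by rewrite gt_eqF.
have a1 i z : `|a i z| <= 1.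
  rewrite /a ler_norml; have /andP[? ?] := mean01 i.
  by case: ((z \in part i) && f z) => /=; apply/andP; split; lra.
have devE (x : s.-tuple X) i :
    est s x (map_tuple f x) i - s%:R * mean f i = \sum_(z <- x) a i z.
  rewrite big_tuple sumrB sumr_const card_ord mulr_natl; congr (_ - _).
  by apply: eq_bigr => j _; rewrite tnth_map.
pose dev i := [set x : s.-tuple X | s%:R * d < `|\sum_(z <- x) a i z|].
have bad_dev : (#|bad s d f| <= \sum_i #|dev i|)%N.
  apply: leq_trans (_ : #|\bigcup_i dev i| <= _)%N.
    apply/subset_leq_card/subsetP => x; rewrite inE => /existsP[i lt].
    by apply/bigcupP; exists i => //; rewrite inE -devE.
  elim/big_rec2: _ => [|i n A _ IH]; first by rewrite cards0.
  by apply: leq_trans (leq_card_setU _ _) _; rewrite leq_add2l.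
have sd0 : 0 < s%:R * d ^+ 2 by rewrite mulr_gt0 ?ltr0n ?exprn_gt0.
have le_k : #|bad s d f|%:R * (s%:R * d ^+ 2) <= k%:R * #|{: s.-tuple X}|%:R.
  apply: le_trans (_ : (\sum_i #|dev i|)%N%:R * (s%:R * d ^+ 2) <= _).
    by rewrite ler_pM2r // ler_nat.
  have -> : k%:R * #|{: s.-tuple X}|%:R = \sum_(i < k) #|{: s.-tuple X}|%:R :> R.
    by rewrite sumr_const card_ord mulr_natl.
  rewrite natr_sum mulr_suml.
  by apply: ler_sum => i _; exact: chebyshev_card.
rewrite ler_pdivlMr // -(ler_pM2r sd0).
have := ler_wpM2l (ler0n R #|{: s.-tuple X}|) ks.
lra.
Qed.

Lemma symmetric_tester (P P' : property X) (eps : R) (s : nat) :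
  (0 < #|X|)%N -> 0 < eps ->
  (forall pi : {perm X}, (forall i, pi @: part i = part i) ->
     forall h, h \in P' -> perm_fun pi h \in P') ->
  P \subset P' -> P' \subset neighborhood P (eps / 2) ->
  (0 < s)%N -> 3 * k%:R <= s%:R * (eps / (4 * k.+1%:R)) ^+ 2 ->
  exists T : s.-tuple X -> s.-tuple bool -> R, eps_tester P eps T.
Proof.
move=> X0 eps0 sym PP' P'P s0; set d := eps / _ => ks.
have k0 : 0 < k.+1%:R :> R by rewrite ltr0n.
have d0 : 0 < d by rewrite divr_gt0 ?mulr_gt0.
have X0R : 0 < #|X|%:R :> R by rewrite ltr0n.
have s0R : 0 < s%:R :> R by rewrite ltr0n.
have N0 : 0 < #|{: s.-tuple X}|%:R :> R by rewrite ltr0n card_tuple expn_gt0 X0.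
(* Accept when the estimates fit some member of [P']. Outside the bad samples, [f] in [P] is its own
   witness, while a witness [g] for any [f] has means within [2 * d] of those of [f]. *)
pose acc x y := [exists g in P', [forall i, `|est s x y i - s%:R * mean g i| <= s%:R * d]].
have goodP f x i : x \notin bad s d f ->
    `|est s x (map_tuple f x) i - s%:R * mean f i| <= s%:R * d.
  by rewrite inE negb_exists => /forallP /(_ i); rewrite -leNgt.
have card1 f : #|bad s d f|%:R = \sum_(x : s.-tuple X) (x \in bad s d f)%:R :> R.
  by rewrite -sum1_card natr_sum big_mkcond; apply: eq_bigr => x _; case: ifP.
exists (fun x y => (acc x y)%:R); split.
- by move=> x y; case: (acc x y); rewrite ?lexx ?ler01.
- move=> f fP; rewrite /accept_prob ler_pdivlMr //.
  have := card_bad s d f X0 d0 ks s0.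
  suff : #|{: s.-tuple X}|%:R - #|bad s d f|%:R <=
      \sum_(x : s.-tuple X) (acc x (map_tuple f x))%:R :> R by lra.
  rewrite card1 -sum1_card natr_sum -sumrB; apply: ler_sum => x _.
  have [xb|xb] := boolP (x \in bad s d f); first by rewrite subrr.
  rewrite subr0 (_ : acc _ _) //; apply/exists_inP.
  exists f; first exact: (subsetP PP').
  by apply/forallP => i; exact: goodP.
move=> f ffar; rewrite /accept_prob ler_pdivrMr //.
have := card_bad s d f X0 d0 ks s0.
suff : \sum_(x : s.-tuple X) (acc x (map_tuple f x))%:R <= #|bad s d f|%:R :> R by lra.
rewrite card1; apply: ler_sum => x _.
have [xb|xb] := boolP (x \in bad s d f); first by case: (acc _ _).
case: (boolP (acc _ _)) => // /exists_inP[g gP' /forallP gx].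
have mean_close i : `|cnt f i - cnt g i| <= 2 * d * #|X|%:R.
  have -> : cnt f i - cnt g i = (mean f i - mean g i) * #|X|%:R.
    by rewrite mulrBl !divfK // gt_eqF.
  rewrite normrM (gtr0_norm X0R) ler_pM2r // -(ler_pM2l s0R).
  rewrite -[X in X * `|_|](gtr0_norm s0R) -normrM.
  have := goodP f x i xb; have := gx i.
  by rewrite !ler_norml => /andP[? ?] /andP[? ?]; apply/andP; split; lra.
have [h hP' fh] := symmetric_close P' f g sym gP'.
have fh2 : (dis f h)%:R <= eps / 2 * #|X|%:R.
  apply: le_trans fh _.
  apply: le_trans (_ : \sum_(i < k) 2 * d * #|X|%:R <= _).
    by apply: ler_sum => i _.
  rewrite sumr_const card_ord -[X in X <= _]mulr_natl mulrA ler_pM2r //.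
  (* This is what [d] was chosen for: [k] errors of [2 * d] fit in [eps / 2], and [k.+1] keeps the
     divisor nonzero. *)
  have -> : eps / 2 = k.+1%:R * (2 * d) by rewrite /d; field; lra.
  have d2 : 0 < 2 * d by rewrite pmulr_rgt0.
  by rewrite (ler_pM2r d2) ler_nat.
have := subsetP P'P _ hP'; rewrite inE => /exists_inP[p pP].
rewrite /hamming_dist ler_pdivrMr // => hp.
case/negP: ffar; rewrite inE; apply/exists_inP; exists p => //.
rewrite /hamming_dist ler_pdivrMr //.
have tri : (dis f p <= dis f h + dis h p)%N.
  apply: leq_trans (leq_card_setU _ _); apply/subset_leq_card/subsetP => z.
  by rewrite !inE; case: (f z); case: (h z); case: (p z).
have : (dis f p)%:R <= (dis f h)%:R + (dis h p)%:R :> R by rewrite -natrD ler_nat.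
rewrite /dis in fh2 *; lra.
Qed.

End SymmetricTestable.

Theorem theorem1p2 (R : realType) (A : Type) (X : A -> finType)
    (X_nonempty : forall a, (0 < #|X a|)%N)
    (P : forall a, property (X a)) :
  constant_sample_testable R P <->
  (forall eps : R, 0 < eps ->
   exists k : nat, forall a : A,
   exists P' : property (X a),
     [/\ part_symmetric k P',
         P a \subset P'
       & P' \subset neighborhood (P a) eps]).
Proof.
split=> [testable eps eps0 | symmetric eps eps0].
  have [s sP] := testable eps eps0.
  exists #|{: (49 * 2 ^ s).-tuple bool}| => a; have [T TP] := sP a.
  exact: tester_symmetric (X_nonempty a) TP.
(* Half of [eps] goes to the distance from [P'] to [P], half to the estimation error. *)
have eps2 : 0 < eps / 2 by lra.
have [k kP] := symmetric _ eps2.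
set d := eps / (4 * k.+1%:R).
have d0 : 0 < d ^+ 2 by rewrite exprn_gt0 // divr_gt0 // mulr_gt0 // ltr0n.
(* The bound gives Chebyshev its [3 * k <= s * d ^+ 2]; the successor ensures [s > 0]. *)
exists (Num.bound (3 * k%:R / d ^+ 2)).+1 => a.
have [P' [[part [partP sym]] PP' P'P]] := kP a.
apply: (symmetric_tester _ _ _ _ partP _ _ _ _ (X_nonempty a) eps0 sym PP' P'P) => //.
rewrite -ler_pdivrMr //; apply: le_trans (_ : (Num.bound (3 * k%:R / d ^+ 2))%:R <= _).
  by apply/ltW/archi_boundP/divr_ge0; [exact: mulr_ge0 | exact: ltW].
by rewrite ler_nat.
Qed.
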